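(* Every numerical semigroup arises as an automaton monoid. That is, for every numerical semigroup $S \subseteq \mathbb{N}_0$ there exists an automaton (Mealy machine) $\mathcal{M}$ such that the semigroup $\Sigma(\mathcal{M})$ generated by $\mathcal{M}$ is a monoid isomorphic to $S$ (with the operation of addition).
   Context: $\mathbb{N}_0$ denotes the set of natural numbers including zero. A numerical semigroup is a submonoid $S$ of $(\mathbb{N}_0,+)$ whose complement $\mathbb{N}_0 \setminus S$ is finite; in particular $0 \in S$. An automaton (Mealy machine) is a triple $\mathcal{M} = (Q, A, \delta)$, where $Q$ is a finite non-empty set of states, $A$ is a finite non-empty symbol alphabet, and $\delta : Q \times A \to Q \times A$ is a (total) transition function. If $\delta(q,a) = (r,b)$, then the automaton in state $q$ reading the symbol $a$ outputs the symbol $b$ and moves to state $r$. Each state $q \in Q$ acts from the right on sequences over $A$: starting in state $q$ and reading a sequence $\alpha$ symbol by symbol, the automaton outputs a sequence denoted $\alpha \cdot q$. Recursively, if $\delta(q,a) = (r,b)$, then $(a\alpha)\cdot q = b(\alpha \cdot r)$ (and the empty word is fixed by every state). This defines a map on the set $A^*$ of finite words, and equally on the set $A^\omega$ of infinite sequences; two words in the states act equally on $A^*$ if and only if they act equally on $A^\omega$. A non-empty word $w = q_1 q_2 \cdots q_k$ of states acts by $\alpha \cdot w = (\cdots((\alpha\cdot q_1)\cdot q_2)\cdots)\cdot q_k$. The semigroup $\Sigma(\mathcal{M})$ generated by $\mathcal{M}$ is the semigroup, under composition, of all transformations of $A^*$ (equivalently, of $A^\omega$) given by the actions of non-empty words over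 $Q$; that is, the subsemigroup of the full transformation semigroup generated by the actions of the states. An automaton monoid is a monoid generated as a semigroup by an automaton, i.e. a monoid isomorphic to $\Sigma(\mathcal{M})$ for some automaton $\mathcal{M}$. *)

(* Defs.v *)
From HB Require Import structures.
From mathcomp Require Import all_boot.
From mathcomp Require Import all_classical.

Set Implicit Arguments.
Unset Strict Implicit.
Unset Printing Implicit Defensive.

Local Open Scope classical_set_scope.

Record numerical_semigroup (S : set nat) : Prop := NumericalSemigroup {
  numsg0 : S 0;
  numsgD : forall m n : nat, S m -> S n -> S (m + n);
  numsg_cofinite : finite_set (~` S)
}.

Record automaton : Type := Automaton {
  state : finType;
  symbol : finType;
  transition : state * symbol -> state * symbol;
  state_nonempty : inhabited state;
  symbol_nonempty : inhabited symbol
}.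

Section Action.
Variable M : automaton.

Fixpoint state_act (q : state M) (u : seq (symbol M)) : seq (symbol M) :=
  if u is a :: v then
    let: (r, b) := transition (q, a) in b :: state_act r v
  else [::].

(* Right action: the leftmost state of w acts first. *)
Definition word_act (w : seq (state M)) (u : seq (symbol M)) :
  seq (symbol M) := foldl (fun v q => state_act q v) u w.

Definition automaton_semigroup : set (seq (symbol M) -> seq (symbol M)) :=
  [set word_act w | w in [set w | w <> [::]]].

End Action.

Arguments automaton_semigroup M : clear implicits.

(* Product of transformations acting on the right: f acts first, then g. *)
Definition rcomp (T : Type) (f g : T -> T) : T -> T := fun x => g (f x).

(* The neutral element of a set of transformations need not be the identity
   map, so it is only required to be neutral on X. *)
Definition is_monoid (T : Type) (X : set T) (op : T -> T -> T) : Prop :=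
  [/\ forall x y, X x -> X y -> X (op x y),
      forall x y z, X x -> X y -> X z -> op x (op y z) = op (op x y) z
    & exists2 e, X e & forall x, X x -> op e x = x /\ op x e = x].

(* A surjective multiplicative map between monoids preserves the neutral
   element, so no separate clause is needed for it. Values of f outside X are
   irrelevant. *)
Definition isomorphic (T U : Type) (X : set T) (opT : T -> T -> T)
    (Y : set U) (opU : U -> U -> U) : Prop :=
  exists2 f : T -> U, set_bij X Y f
    & forall x y, X x -> X y -> f (opT x y) = opU (f x) (f y).

(* Main.v *)
Require Import Defs.
From HB Require Import structures.
From mathcomp Require Import all_boot.
From mathcomp Require Import all_classical.
From mathcomp Require Import zify.

(** Fix [k > 0] such that [S] contains every [n >= k], and let [n] act on
    words over [Z/(k+1)] as the [n]-th power of a modified odometer: the first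
    digit [a] becomes [n + a] modulo [k + 1], and the carry
    [(n + a) %/ (k + 1)] is multiplied by [k] before it is propagated.  This is
    a faithful action of the additive monoid of naturals.  Carries are multiples
    of [k], hence in [S]; and if [n <= k ^ 2] then so is the carry.  Thus the
    elements of [S] up to [k ^ 2], which generate [S], are the states of an
    automaton generating the image of [S]. *)

Set Implicit Arguments.
Unset Strict Implicit.
Unset Printing Implicit Defensive.

Local Open Scope classical_set_scope.

Section Odometer.
Variable k : nat.

Definition carry (n a : nat) : nat := k * ((n + a) %/ k.+1).

Definition rotate (n : nat) (a : 'I_k.+1) : 'I_k.+1 := inord ((n + a) %% k.+1).

Fixpoint odometer (n : nat) (u : seq 'I_k.+1) : seq 'I_k.+1 :=
  if u is a :: v then rotate n a :: odometer (carry n a) v else [::].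

Lemma val_rotate n a : rotate n a = (n + a) %% k.+1 :> nat.
Proof. by rewrite inordK // ltn_mod. Qed.

Lemma odometer0 u : odometer 0 u = u.
Proof.
elim: u => //= a u IH; congr (_ :: _).
  by apply: val_inj; rewrite /= val_rotate add0n modn_small.
by rewrite /carry add0n divn_small // muln0.
Qed.

(** Adding [m] first and then [n] splits the quotient of [m + n + a] by [k.+1], since the rotated
    digit is the remainder of [m + a]. This cocycle identity makes [odometer] additive in the
    exponent. *)
Lemma carryD m n (a : 'I_k.+1) :
  carry (m + n) a = carry m a + carry n (rotate m a).
Proof.
rewrite /carry val_rotate -mulnDr; congr (_ * _).
by rewrite addnAC {1}(divn_eq (m + a) k.+1) -addnA divnMDl // (addnC n).
Qed.

Lemma odometerD m n u : odometer (m + n) u = odometer n (odometer m u).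
Proof.
elim: u m n => //= a u IH m n; rewrite carryD IH; congr (_ :: _).
by apply: val_inj; rewrite /= !val_rotate modnDmr addnAC addnC.
Qed.

(** Here [n + a <= k ^ 2 + k < k.+1 ^ 2], so the quotient is at most [k]. *)
Lemma carry_le n (a : 'I_k.+1) : n <= k ^ 2 -> carry n a <= k ^ 2.
Proof.
move=> n_le; rewrite /carry expnS expn1 leq_mul2l.
have -> : ((n + a) %/ k.+1 <= k) = (n + a < k.+1 * k.+1).
  by rewrite -ltnS ltn_divLR.
by have := ltn_ord a; rewrite orbC; nia.
Qed.

(* [m] and [m + p] can only agree on the first digit if [p = (k + 1) p'], and
   then their carries differ by [k p'], which is smaller than [p]. *)
Lemma odometer_eqD m p : 0 < k -> odometer m =1 odometer (m + p) -> p = 0.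
Proof.
(* [m] stays general: the induction hypothesis is applied at [carry m 0], the exponent acting after
   a first digit 0. *)
move=> k_gt0; elim/ltn_ind: p m => p IH m eq_mp.
have /eqP p_dvd : p %% k.+1 == 0.
  have [/(congr1 val)] := eq_mp [:: ord0].
  rewrite /= !val_rotate !addn0 => /eqP.
  by rewrite -{1}(addn0 m) eqn_modDl mod0n eq_sym.
have def_p : p = p %/ k.+1 * k.+1 by rewrite {1}(divn_eq p k.+1) p_dvd addn0.
have [//|p_gt0] := posnP p.
have /IH : k * (p %/ k.+1) < p by nia.
have carry_mp : carry (m + p) 0 = carry m 0 + k * (p %/ k.+1).
  by rewrite /carry !addn0 {1}def_p divnDMl // mulnDr.
move=> /(_ (carry m 0)) IHp; suff : k * (p %/ k.+1) = 0 by nia.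
by apply: IHp => u; have [_] := eq_mp (ord0 :: u); rewrite carry_mp.
Qed.

Lemma odometer_inj : 0 < k -> injective odometer.
Proof.
move=> k_gt0 m n eq_mn; wlog le_mn : m n eq_mn / m <= n.
  by move=> W; have [/W|/ltnW/W] := leqP m n => ->.
have := @odometer_eqD m (n - m) k_gt0; rewrite subnKC // eq_mn => /(_ _).
by move=> /(_ (fun=> erefl)); lia.
Qed.

End Odometer.

Section OdometerAutomaton.
Variables (S : set nat) (k : nat).
Hypotheses (hS : numerical_semigroup S) (k_gt0 : 0 < k).
Hypothesis S_ge : forall n, k <= n -> S n.

Definition odometer_state : finType := {i : 'I_(k ^ 2).+1 | `[< S i >]}.

Definition state_val (q : odometer_state) : nat := val (val q).

Lemma state_valP q : S (state_val q).
Proof. by apply/asboolP; exact: valP q. Qed.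

Lemma state_of n : S n -> n <= k ^ 2 -> exists q, state_val q = n.
Proof.
move=> Sn n_le; have Sn' : `[< S (inord n : 'I_(k ^ 2).+1) >].
  by apply/asboolP; rewrite inordK.
exists (exist (fun i : 'I_(k ^ 2).+1 => is_true `[< S i >]) _ Sn').
by rewrite /state_val /= inordK.
Qed.

(** A multiple of [k] is either 0 or at least [k]. *)
Lemma S_carry n a : S (carry k n a).
Proof.
rewrite /carry; case: (_ %/ _) => [|c]; first by rewrite muln0; exact: numsg0.
by apply: S_ge; rewrite leq_pmulr.
Qed.

(** [inord] and [insubd] only make the map total: by [carry_le] and [S_carry] the carry of a state
    is again a state. *)
Definition odometer_transition (x : odometer_state * 'I_k.+1) :
    odometer_state * 'I_k.+1 :=
  (insubd x.1 (inord (carry k (state_val x.1) x.2)),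
   rotate (state_val x.1) x.2).

Lemma state_val_transition q a :
  state_val (odometer_transition (q, a)).1 = carry k (state_val q) a.
Proof.
have carryK : (inord (carry k (state_val q) a) : 'I_(k ^ 2).+1) =
    carry k (state_val q) a :> nat.
  by rewrite inordK // ltnS carry_le //; exact: ltn_ord (val q).
rewrite {1}/state_val /= insubdK ?carryK //.
by apply/asboolP; rewrite carryK; exact: S_carry.
Qed.

Lemma odometer_state_inhabited : inhabited odometer_state.
Proof. by have [//|q _] := @state_of 0 (numsg0 hS); constructor. Qed.

Definition odometer_automaton : automaton :=
  @Automaton odometer_state 'I_k.+1 odometer_transition
    odometer_state_inhabited (inhabits ord0).

Lemma state_act_odometer (q : state odometer_automaton) u :
  state_act q u = odometer (state_val q) u.
Proof.
elim: u q => //= a u IH q.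
by rewrite IH state_val_transition.
Qed.

Lemma word_act_odometer (w : seq (state odometer_automaton)) :
  word_act w = odometer (sumn (map state_val w)) :> (seq 'I_k.+1 -> _).
Proof.
apply/funext => u; elim: w u => [|q w IH] u /=; first by rewrite odometer0.
by rewrite odometerD -state_act_odometer -IH.
Qed.

Lemma S_sumn (w : seq odometer_state) : S (sumn (map state_val w)).
Proof.
elim: w => [|q w IH] /=; first exact: numsg0.
by apply: numsgD => //; exact: state_valP.
Qed.

Lemma state_word n : S n ->
  exists2 w : seq odometer_state, w <> [::] & sumn (map state_val w) = n.
Proof.
elim/ltn_ind: n => n IH Sn; have [n_le|n_gt] := leqP n (k ^ 2).
  (* A one-letter word also serves [n = 0], where the empty word is excluded. *)
  by have [q qn] := state_of Sn n_le; exists [:: q] => //=; rewrite qn addn0.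
(* Since [n >= k ^ 2 + 1 >= 2 * k], the difference [n - k] is at least [k] and so lies in [S]; the
   letter split off is the state [k]. *)
have [w _ wE] : exists2 w : seq odometer_state, w <> [::] &
    sumn (map state_val w) = n - k.
  by apply: IH; [lia | apply: S_ge; nia].
have [||q qk] := @state_of k; [exact: S_ge | by nia |].
by exists (q :: w) => //=; rewrite wE qk; nia.
Qed.

Lemma automaton_semigroup_odometer :
  automaton_semigroup odometer_automaton = @odometer k @` S.
Proof.
apply/seteqP; split => [_ [w _ <-]|_ [n Sn <-]].
  by exists (sumn (map state_val w)); [exact: S_sumn | rewrite word_act_odometer].
have [w w_neq0 wn] := state_word Sn.
by exists w => //; rewrite word_act_odometer wn.
Qed.

End OdometerAutomaton.

Lemma numerical_semigroup_ge (S : set nat) : numerical_semigroup S ->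
  exists2 k, 0 < k & forall n, k <= n -> S n.
Proof.
(* One more than the largest gap; the successor keeps [k] positive even when there are no gaps. *)
case=> _ _ /finite_seqP[s sE]; exists (\max_(i <- s) i).+1 => // n n_gt.
apply: contrapT => /= nSn; have : (~` S) n by [].
by rewrite sE /= => /(@leq_bigmax_seq _ _ xpredT id) => /(_ isT); lia.
Qed.

Theorem mainTheorem1 (S : set nat) (hS : numerical_semigroup S) :
  exists M : automaton,
    is_monoid (automaton_semigroup M) (@rcomp (seq (symbol M))) /\
    isomorphic S addn (automaton_semigroup M) (@rcomp (seq (symbol M))).
Proof.
have [k k_gt0 S_ge] := numerical_semigroup_ge hS.
exists (odometer_automaton k hS).
rewrite (automaton_semigroup_odometer hS k_gt0 S_ge) /=.
have odoD m n : odometer (m + n) = rcomp (@odometer k m) (odometer n).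
  by apply/funext => u; exact: odometerD.
split; last first.
  exists (@odometer k) => //; split=> [n Sn|m n _ _|_ [n Sn <-]].
  - by exists n.
  - exact: odometer_inj.
  - by exists n.
split=> [_ _ [m Sm <-] [n Sn <-]|//|].
  by exists (m + n); [exact: numsgD | exact: odoD].
(* The neutral element is the image of 0, itself the action of a one-letter word. *)
exists (@odometer k 0); first by exists 0 => //; exact: numsg0.
by move=> _ [n Sn <-]; rewrite -!odoD addn0.
Qed.
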